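(* (i) Let $1\le s\le d-1$ and let $(\mathbf A,\mathbf b)\in\mathbb R^{m\times(d+1)}$ be $s$-sparse affine phase retrievable for $\mathbb R^d$. Then $m\ge 2s+1$. (ii) Let $m\ge 2s+1$. Then a generic $(\mathbf A,\mathbf b)\in\mathbb R^{m\times(d+1)}$ is $s$-sparse affine phase retrievable for $\mathbb R^d$.
   Context: Write $(\mathbf A,\mathbf b)$ with $\mathbf A=(\mathbf a_1,\ldots,\mathbf a_m)^\top\in\mathbb R^{m\times d}$, $\mathbf b=(b_1,\ldots,b_m)^\top\in\mathbb R^m$, and $\mathbf M_{\mathbf A,\mathbf b}(\mathbf x)=(|\langle\mathbf a_1,\mathbf x\rangle+b_1|,\ldots,|\langle\mathbf a_m,\mathbf x\rangle+b_m|)$. Let $\Sigma_s(\mathbb R^d)=\{\mathbf x\in\mathbb R^d:\|\mathbf x\|_0\le s\}$, where $\|\mathbf x\|_0$ is the number of nonzero entries. $(\mathbf A,\mathbf b)$ is $s$-sparse affine phase retrievable for $\mathbb R^d$ if $\mathbf M_{\mathbf A,\mathbf b}$ is injective on $\Sigma_s(\mathbb R^d)$. A property holds for generic elements of $\mathbb R^N$ if it holds on a dense open set whose complement is a null set. *)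

(* Defs.v *)
From HB Require Import structures.
From mathcomp Require Import all_boot all_order all_algebra.
From mathcomp Require Import all_classical all_reals topology num_topology.
Set Implicit Arguments. Unset Strict Implicit. Unset Printing Implicit Defensive.
Import Order.TTheory GRing.Theory Num.Theory numFieldTopology.Exports.
Local Open Scope ring_scope.
Local Open Scope classical_set_scope.

Definition affine_meas (R : realType) (m d : nat)
  (A : 'M[R]_(m, d)) (b : 'cV[R]_m) (x : 'cV[R]_d) : 'cV[R]_m :=
  \col_i `| (A *m x) i ord0 + b i ord0 |.

Definition sparse (R : realType) (d s : nat) (x : 'cV[R]_d) : bool :=
  (#|[set i : 'I_d | x i ord0 != 0%R]| <= s)%N.

Definition sparse_affine_PR (R : realType) (m d s : nat)
  (A : 'M[R]_(m, d)) (b : 'cV[R]_m) : Prop :=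
  forall x y : 'cV[R]_d, sparse s x -> sparse s y ->
    affine_meas A b x = affine_meas A b y -> x = y.

Definition box (R : realType) (m n : nat) (lo hi : 'M[R]_(m, n)) : set 'M[R]_(m, n) :=
  [set X | forall i j, lo i j <= X i j <= hi i j].

Definition box_vol (R : realType) (m n : nat) (lo hi : 'M[R]_(m, n)) : R :=
  \prod_(i < m) \prod_(j < n) (hi i j - lo i j).

Definition null_set (R : realType) (m n : nat) (S : set 'M[R]_(m, n)) : Prop :=
  forall eps : R, 0 < eps ->
    exists lo hi : nat -> 'M[R]_(m, n),
      (forall k i j, lo k i j <= hi k i j) /\
      S `<=` \bigcup_k box (lo k) (hi k) /\
      (forall N : nat, \sum_(k < N) box_vol (lo k) (hi k) < eps).

Definition generic (R : realType) (m n : nat) (P : 'M[R]_(m, n) -> Prop) : Prop :=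
  exists U : set 'M[R]_(m, n),
    open U /\ dense U /\ null_set (~` U) /\ (forall M, U M -> P M).

(* Main.v *)
(** Two vectors [x], [y] have the same measurements iff every row [j] satisfies
    [<a_j, x - y> = 0] or [<a_j, x + y> = - 2 b_j].

    (i) Write [s = k + 1], keep [k + 2] columns, [A = (p C q)], and suppose
    [m <= 2 k + 2].  Injectivity forces [C] to have rank [k], so some [k] rows [K]
    make [C_K] invertible, and at most [k + 2] rows [J] remain.  With
    [u = x - y] and [v = x + y], the vector [x] has last entry [0] and [y] has
    first entry [0] iff [u] and [v] agree in the first entry and are opposite in
    the last one; given these two entries, the equations on [K] are solved by the
    middle block.  If [A_J] has a kernel vector, take it as [u] and solve for [v] on
    [K]; otherwise [A_J] is square invertible, which gives [v], and then [u] on [K];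
    should that [u] vanish, any nonzero [u] with last entry [0] and [A_K u = 0] does.

    (ii) For fixed supports and signs the equations are linear in the homogenized
    unknown [z = (x, y, 1)], which has at most [2 s + 1 <= m] coordinates, and row
    [j] of the system is [M_j L_j] with [L_j z <> 0].  For a generic [M] each row
    cuts down the space of solutions, so nothing is left after [m] rows.  Genericity
    comes from minors: they are affine in each entry of [M], and such a function [f],
    if not identically zero, vanishes on a closed null set with empty interior, by
    induction on the number of variables: near a zero where the slope of [f] in some
    variable is nonzero, the zero set is a Lipschitz graph, and the slope itself
    depends on fewer variables. *)
Require Import Defs.
From HB Require Import structures.
From mathcomp Require Import all_boot all_order all_algebra.
From mathcomp Require Import all_classical all_reals topology num_topology.
From mathcomp Require Import zify ring lra.
Set Implicit Arguments. Unset Strict Implicit. Unset Printing Implicit Defensive.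
Import Order.TTheory GRing.Theory Num.Theory numFieldTopology.Exports.
Local Open Scope ring_scope.

Lemma inj_row_full (F : fieldType) (m n : nat) (A : 'M[F]_(m, n)) :
  (forall u : 'cV_n, A *m u = 0 -> u = 0) -> row_full A.
Proof.
move=> injA; rewrite /row_full -mxrank_tr -[_ == _]/(row_free A^T).
apply: inj_row_free => v vA0; apply: trmx_inj; rewrite trmx0; apply: injA.
by apply: trmx_inj; rewrite trmx_mul trmxK trmx0.
Qed.

(** * Vectors supported on selected coordinates *)

Section SparseVectors.
Variables (R : realType) (d : nat).

Lemma sparseE (s : nat) (x : 'cV[R]_d) :
  sparse s x = (#|[set i | x i ord0 != 0%R]| <= s)%N.
Proof.
congr (_ <= _)%N; apply: eq_card => i; rewrite inE.
by apply/idP/idP => [/set_mem|/mem_set].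
Qed.

Lemma colsub1_mul (n : nat) (h : 'I_n -> 'I_d) (x : 'cV[R]_n) (j : 'I_n) :
  injective h -> (colsub h 1%:M *m x) (h j) ord0 = x j ord0.
Proof.
move=> hI; rewrite mxE (bigD1 j) //= big1 => [|l lj].
  by rewrite !mxE eqxx mul1r addr0.
by rewrite !mxE (inj_eq hI) eq_sym (negPf lj) mul0r.
Qed.

Lemma colsub1_mul0 (n : nat) (h : 'I_n -> 'I_d) (x : 'cV[R]_n) (i : 'I_d) :
  i \notin codom h -> (colsub h 1%:M *m x) i ord0 = 0.
Proof.
move=> ih; rewrite mxE big1 // => l _; rewrite !mxE.
case: eqP => [il|_]; last by rewrite mul0r.
by rewrite il codom_f in ih.
Qed.

Lemma sparse_colsub1 (n : nat) (h : 'I_n.+1 -> 'I_d) (x : 'cV[R]_n.+1)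
    (j : 'I_n.+1) :
  injective h -> x j ord0 = 0 -> sparse n (colsub h 1%:M *m x).
Proof.
move=> hI xj0; rewrite sparseE.
apply: (@leq_trans #|h @: [set~ j]|); last first.
  by rewrite (leq_trans (leq_imset_card _ _)) // cardsC1 card_ord.
apply/subset_leq_card/fintype.subsetP => i; rewrite inE => xi0.
have [/codomP[l il]|/colsub1_mul0] := boolP (i \in codom h); last first.
  by move=> e0; rewrite e0 eqxx in xi0.
apply/imsetP; exists l => //; rewrite !inE.
by apply: contraNneq xi0 => lj; rewrite il colsub1_mul // lj xj0.
Qed.

Lemma colsub1_support (x : 'cV[R]_d) (T : {set 'I_d}) :
  (forall i, i \notin T -> x i ord0 = 0) ->
  colsub (enum_val : 'I_#|T| -> 'I_d) 1%:M *m rowsub enum_val x = x.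
Proof.
move=> xT; apply/matrixP => i o; rewrite (ord1 o) {o}.
have [iT|iT] := boolP (i \in T).
  by rewrite -(enum_rankK_in iT iT) colsub1_mul ?mxE //; apply: enum_val_inj.
rewrite xT // colsub1_mul0 //.
by apply: contra iT => /codomP[j ->]; apply: enum_valP.
Qed.

End SparseVectors.

(** * Lower bound on the number of measurements *)

Section LowerBound.
Variables (R : realType) (m : nat).

(** In the first case the two affine forms of row [i] are equal; in the second they are half of
    [(A *m u) i ord0] and its opposite. *)
Lemma affine_meas_eq (d : nat) (A : 'M[R]_(m, d)) (b : 'cV_m) (u v : 'cV_d) :
  (forall i, (A *m u) i ord0 = 0 \/ (A *m v) i ord0 = - 2 * b i ord0) ->
  affine_meas A b (2^-1 *: (v + u)) = affine_meas A b (2^-1 *: (v - u)).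
Proof.
move=> uv; apply/matrixP => i o; rewrite [LHS]mxE [RHS]mxE.
rewrite -!scalemxAr mulmxDr mulmxBr.
move: (A *m u) (A *m v) uv => p q uv; rewrite !mxE.
case: (uv i) => ->; first by rewrite oppr0 addr0.
by rewrite -[RHS]normrN; congr `|_|; field.
Qed.

(** The case [d = k + 2], [s = k + 1], where being sparse means having a zero entry. *)
Lemma sparse_affine_PR_core (k : nat) (A : 'M[R]_(m, 1 + (k + 1)))
    (b : 'cV[R]_m) :
  (forall x y : 'cV_(1 + (k + 1)),
     (exists i, x i ord0 = 0) -> (exists i, y i ord0 = 0) ->
     affine_meas A b x = affine_meas A b y -> x = y) ->
  (2 * k + 2 < m)%N.
Proof.
move=> inj; rewrite ltnNge; apply/negP => lem.
(* Opposite entries give [(v + u) / 2] a zero entry and equal entries give [(v - u) / 2] one, so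
   injectivity would force [u = 0]. *)
have noUV (u v : 'cV_(1 + (k + 1))) : u != 0 ->
    (exists i, v i ord0 = - u i ord0) -> (exists i, v i ord0 = u i ord0) ->
    (forall i, (A *m u) i ord0 = 0 \/ (A *m v) i ord0 = - 2 * b i ord0) ->
    False.
  move=> u0 [i vi] [j vj] /affine_meas_eq /inj xy.
  have x0 : exists l, (2^-1 *: (v + u)) l ord0 = 0.
    by exists i; rewrite !mxE vi addNr mulr0.
  have y0 : exists l, (2^-1 *: (v - u)) l ord0 = 0.
    by exists j; rewrite !mxE vj subrr mulr0.
  have h0 : 2^-1 != 0 :> R by rewrite invr_eq0 pnatr_eq0.
  move: (xy x0 y0) => /(scalerI h0).
  move/addrI/eqP; rewrite -addr_eq0 -mulr2n -scaler_nat scaler_eq0.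
  by rewrite pnatr_eq0 (negPf u0).
pose C := lsubmx (rsubmx A).
have Amul (al be : 'cV_1) w : A *m col_mx al (col_mx w be) =
    lsubmx A *m al + (C *m w + rsubmx (rsubmx A) *m be).
  by rewrite -[A in LHS]hsubmxK -[rsubmx A in LHS]hsubmxK !mul_row_col.
pose F : 'I_(1 + (k + 1)) := lshift _ ord0.
pose G : 'I_(1 + (k + 1)) := rshift 1 (rshift k ord0).
have colF (al be : 'cV_1) (w : 'cV[R]_k) :
  col_mx al (col_mx w be) F ord0 = al ord0 ord0 by rewrite col_mxEu.
have colG (al be : 'cV_1) (w : 'cV[R]_k) :
  col_mx al (col_mx w be) G ord0 = be ord0 ord0 by rewrite !col_mxEd.
(* A kernel vector of [C], padded by zeros at both ends, has the same measurements as [0]. *)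
have fullC : row_full C.
  apply: inj_row_full => w Cw0.
  have : col_mx 0 (col_mx w 0) = 0 :> 'cV_(1 + (k + 1)).
    apply: inj; [by exists F; rewrite colF mxE | by exists F; rewrite mxE |].
    by rewrite /affine_meas Amul Cw0 !mulmx0 !addr0.
  by move/eqP; rewrite !col_mx_eq0 => /and3P[_ /eqP].
pose f := fullrankfun fullC.
have fI : injective f by apply: fullrankfun_inj.
have unitCK : rowsub f C \in unitmx by apply: fullrowsub_unit.
have solveK (c : 'cV[R]_m) (al be : 'cV_1) : exists w, forall a,
    (A *m col_mx al (col_mx w be)) (f a) ord0 = c (f a) ord0.
  pose r := rowsub f (c - lsubmx A *m al - rsubmx (rsubmx A) *m be).
  exists (invmx (rowsub f C) *m r) => a; rewrite Amul.
  have := congr1 (fun M : 'cV_k => M a ord0) (mulKVmx unitCK r).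
  rewrite mul_rowsub_mx [in LHS]mxE => e.
  by rewrite [LHS]mxE [X in _ + X]mxE e /r !mxE; ring.
pose J := (~: [set f a | a : 'I_k]).
have cJ : (#|J| <= k + 2)%N.
  have := cardsC [set f a | a : 'I_k].
  rewrite card_imset // !card_ord -/J; lia.
have JP i : i \in J \/ exists a, i = f a.
  rewrite inE; case: imsetP => [[a _ ->]|_]; [by right; exists a | by left].
pose B := rowsub (enum_val : 'I_#|J| -> 'I_m) A.
have BE (u : 'cV_(1 + (k + 1))) (i : 'I_m) (iJ : i \in J) :
    (A *m u) i ord0 = (B *m u) (enum_rank_in iJ i) ord0.
  by rewrite /B mul_rowsub_mx [RHS]mxE enum_rankK_in.
have vE (u : 'cV[R]_(1 + (k + 1))) :
    u = col_mx (usubmx u) (col_mx (usubmx (dsubmx u)) (dsubmx (dsubmx u))).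
  by rewrite !vsubmxK.
have [fullB|nfullB] := boolP (row_full B); last first.
  have [u [u0 Bu0]] : exists u : 'cV_(1 + (k + 1)), u != 0 /\ B *m u = 0.
    apply: contrapT => no; move/negP: nfullB; apply; apply: inj_row_full => u Bu.
    by apply/eqP; apply: contrapT => /negP u0; apply: no; exists u.
  have [w Hw] := solveK (- 2 *: b) (usubmx u) (- dsubmx (dsubmx u)).
  apply: (noUV u (col_mx (usubmx u) (col_mx w (- dsubmx (dsubmx u)))) u0).
  - by exists G; rewrite colG [in RHS](vE u) colG mxE.
  - by exists F; rewrite colF [in RHS](vE u) colF.
  - move=> i; case: (JP i) => [iJ|[a ->]]; [left|right].
      by rewrite (BE _ _ iJ) Bu0 mxE.
    by rewrite Hw mxE.
(* Rank [k + 2] with at most [k + 2] rows: [B] is square and invertible. *)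
have [B' BB'] : exists B', B *m B' = 1%:M.
  have kJ : (1 + (k + 1) <= #|J|)%N by rewrite -(eqP fullB) rank_leq_row.
  by apply/row_freeP; rewrite /row_free (eqP fullB) eqn_leq kJ addnC -addnA.
pose v := B' *m rowsub enum_val (- 2 *: b).
have Bv i : i \in J -> (A *m v) i ord0 = - 2 * b i ord0.
  by move=> iJ; rewrite (BE _ _ iJ) /v mulmxA BB' mul1mx !mxE enum_rankK_in.
have [w Hw] := solveK 0 (usubmx v) (- dsubmx (dsubmx v)).
set u := col_mx _ _ in Hw.
have Au i : (A *m u) i ord0 = 0 \/ (A *m v) i ord0 = - 2 * b i ord0.
  by case: (JP i) => [/Bv|[a ->]]; [right|left; rewrite Hw mxE].
have uG : v G ord0 = - u G ord0 by rewrite colG [in LHS](vE v) colG !mxE opprK.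
have uF : v F ord0 = u F ord0 by rewrite colF [in LHS](vE v) colF.
have [u0|u0] := eqVneq u 0; last first.
  by apply: (noUV u v u0) => //; [exists G | exists F].
(* Since [u = 0], the last entry of [v] is [0], so a vector with last entry [0] is there both equal
   and opposite to [v]; first entry [1] keeps it nonzero. *)
have [w' Hw'] := solveK 0 1 0.
apply: (noUV (col_mx 1 (col_mx w' 0)) v).
- by rewrite col_mx_eq0 negb_and oner_eq0.
- by exists G; rewrite uG u0 colG mxE oppr0 mxE oppr0.
- by exists G; rewrite uG u0 colG !mxE oppr0.
by move=> i; case: (JP i) => [/Bv|[a ->]]; [right|left; rewrite Hw' mxE].
Qed.

(** Restriction to the vectors supported on the first [k + 2] coordinates, with [s = k + 1]; the
    bound [s <= d - 1] provides that many. *)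
Lemma sparse_affine_PR_lower_bound (d s : nat) (A : 'M[R]_(m, d))
    (b : 'cV[R]_m) :
  (1 <= s)%N -> (s <= d - 1)%N -> sparse_affine_PR s A b -> (2 * s + 1 <= m)%N.
Proof.
case: s => // k _ sd PR.
have hd : (1 + (k + 1) <= d)%N by lia.
pose h := widen_ord hd.
have hI : injective h by move=> i j /(congr1 val) /= /val_inj.
pose E : 'M[R]_(d, _) := colsub h 1%:M.
suff : (2 * k + 2 < m)%N by lia.
apply: (@sparse_affine_PR_core k (A *m E) b) => x y [i xi] [j yj].
rewrite /affine_meas -!mulmxA => xy.
have e : E *m x = E *m y.
  apply: PR => //; rewrite -addn1.
    exact: (@sparse_colsub1 _ _ _ h x i).
  exact: (@sparse_colsub1 _ _ _ h y j).
by apply/matrixP => l o; rewrite (ord1 o) -!(@colsub1_mul _ _ _ h) // -/E e.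
Qed.

End LowerBound.

(** * Null sets and their countable unions *)

Section NullSets.
Variables (R : realType) (m n : nat).
Implicit Types S : set 'M[R]_(m, n).

Lemma ler_sum_uniq (T : eqType) (F : T -> R) (s s' : seq T) :
  (forall t, 0 <= F t) -> uniq s -> uniq s' -> {subset s <= s'} ->
  \sum_(t <- s) F t <= \sum_(t <- s') F t.
Proof.
move=> F0 us us' ss'; rewrite [leRHS](bigID (mem s)) /= -[X in X + _]big_filter.
have /(perm_big _) -> : perm_eq [seq t <- s' | t \in s] s.
  apply: uniq_perm => //; first exact: filter_uniq.
  by move=> t; rewrite mem_filter andb_idr // => /ss'.
by rewrite lerDl sumr_ge0.
Qed.

Lemma box_vol_ge0 (lo hi : 'M[R]_(m, n)) :
  (forall i j, lo i j <= hi i j) -> 0 <= box_vol lo hi.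
Proof.
by move=> lohi; do 2![apply: prodr_ge0 => ? _]; rewrite subr_ge0 lohi.
Qed.

(** [pickle_inv] turns the cover into a sequence, where a number coding no element gets the box
    reduced to [0]. The entry [v] ensures that this box has volume [0]: an empty product would be
    [1]. *)
Lemma null_set_countable (v : 'I_m * 'I_n) S :
  (forall eps : R, 0 < eps -> exists (T : countType) (lo hi : T -> 'M[R]_(m, n)),
     [/\ forall t i j, lo t i j <= hi t i j,
         forall M, S M -> exists t, box (lo t) (hi t) M &
         forall s : seq T, uniq s ->
           \sum_(t <- s) box_vol (lo t) (hi t) < eps]) ->
  null_set S.
Proof.
move=> cov eps /cov[T [lo [hi [lohi Scov vol]]]].
exists (fun k => oapp lo 0 (pickle_inv k)), (fun k => oapp hi 0 (pickle_inv k)).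
split=> [k i j|]; first by case: (pickle_inv k : option T) => [t|] /=.
split=> [M /Scov[t Mt]|N].
  by exists (pickle t) => //; rewrite pickleK_inv.
have := vol (pmap (@pickle_inv T) (iota 0 N)).
rewrite (pmap_uniq pickle_invK) ?iota_uniq // => /(_ isT).
rewrite big_pmap -[N in iota 0 N]subn0 -/(index_iota 0 N) big_mkord.
apply: le_lt_trans; apply: ler_sum => k _; case: (pickle_inv k : option T) => //=.
by rewrite /box_vol (bigD1 v.1) //= (bigD1 v.2) //= !mxE subrr !mul0r.
Qed.

Lemma null_setS S S' : (S `<=` S')%classic -> null_set S' -> null_set S.
Proof.
move=> SS' nS' eps /nS'[lo [hi [lohi [cov vol]]]].
by exists lo, hi; split=> //; split=> // M /SS' /cov.
Qed.

(** The set of index [k] is covered with volume below [eps / 2 ^ (k + 1)]; partial sums stay at most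
    [eps * (1 - 2^-1 ^+ K)], hence strictly below [eps]. *)
Lemma null_set_bigcup (v : 'I_m * 'I_n) (S : nat -> set 'M[R]_(m, n)) :
  (forall k, null_set (S k)) -> null_set (\bigcup_k S k)%classic.
Proof.
move=> nS; apply: (null_set_countable v) => eps eps0.
have /choice[lo] k : exists lo : nat -> 'M[R]_(m, n),
    exists hi : nat -> 'M[R]_(m, n),
    (forall l i j, lo l i j <= hi l i j) /\
    (S k `<=` \bigcup_l box (lo l) (hi l))%classic /\
    (forall N : nat, \sum_(l < N) box_vol (lo l) (hi l) < eps * 2^-1 ^+ k.+1).
  by apply: nS; rewrite mulr_gt0 // exprn_gt0 // invr_gt0.
move=> /choice[hi H].
exists (nat * nat)%type, (fun t => lo t.1 t.2), (fun t => hi t.1 t.2).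
split=> [[k l] i j|M [k _ SkM]|s us] /=.
- by have [] := H k.
- by have [_ [/(_ M SkM)[l _ Ml] _]] := H k; exists (k, l).
have [K sK] : exists K : nat,
    {subset s <= [seq (k, l) | k <- iota 0 K, l <- iota 0 K]}.
  exists (\max_(t <- s) maxn t.1 t.2).+1 => -[k l] kls.
  have := @leq_bigmax_seq _ s xpredT (fun t => maxn t.1 t.2) _ kls isT.
  rewrite -ltnS gtn_max => /andP[kK lK].
  by apply/allpairsP; exists (k, l); split; rewrite ?mem_iota.
have vol0 (t : nat * nat) : 0 <= box_vol (lo t.1 t.2) (hi t.1 t.2).
  by apply: box_vol_ge0 => i j; have [] := H t.1.
apply: (le_lt_trans (ler_sum_uniq vol0 us _ sK)).
  by apply: allpairs_uniq; rewrite ?iota_uniq // => -[a b] [c d].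
rewrite big_allpairs_dep /= -[K in iota 0 K]subn0 -/(index_iota 0 K).
have geo : \sum_(0 <= k < K) eps * 2^-1 ^+ k.+1 = eps * (1 - 2^-1 ^+ K).
  elim: K {sK} => [|K IH]; first by rewrite big_geq // expr0 subrr mulr0.
  by rewrite big_nat_recr //= IH exprS; field.
apply: (@le_lt_trans _ _ (eps * (1 - 2^-1 ^+ K))).
  rewrite -geo; apply: ler_sum => k _.
  rewrite big_mkord.
  by have [_ [_ /(_ K)/ltW]] := H k.
by rewrite -[ltRHS]mulr1 ltr_pM2l // gtrBl exprn_gt0 // invr_gt0.
Qed.

Lemma null_setU (v : 'I_m * 'I_n) S S' :
  null_set S -> null_set S' -> null_set (S `|` S')%classic.
Proof.
move=> nS nS'.
apply: (@null_setS _ (\bigcup_k (if k is 0%N then S else S'))%classic).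
  by move=> M [SM|SM]; [exists 0%N|exists 1%N].
by apply: (null_set_bigcup v) => -[|k].
Qed.

Lemma null_set0 (v : 'I_m * 'I_n) : null_set (set0 : set 'M[R]_(m, n)).
Proof.
apply: (null_set_countable v) => eps eps0.
exists nat, (fun=> 0), (fun=> 0); split=> // s _.
rewrite big1 // => k _.
by rewrite /box_vol (bigD1 v.1) //= (bigD1 v.2) //= !mxE subrr !mul0r.
Qed.

End NullSets.

(** * Functions that are Lipschitz on cubes *)

Section Lipschitz.
Variables (R : realType) (m n : nat).
Implicit Types (f g : 'M[R]_(m, n) -> R) (M : 'M[R]_(m, n)).

(** Lipschitz continuity on each cube for the sup distance, of which [h] is an upper bound;
    polynomials in the entries have it. *)
Definition bounded_lipschitz f := forall B : R, 0 <= B ->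
  exists2 C : R, 0 <= C & forall M M' (h : R),
    (forall i j, `|M i j| <= B) -> (forall i j, `|M' i j| <= B) ->
    (forall i j, `|M i j - M' i j| <= h) -> `|f M - f M'| <= C * h.

Lemma bounded_lipschitz_cst c : bounded_lipschitz (fun=> c).
Proof. by move=> B _; exists 0 => // *; rewrite subrr normr0 mul0r. Qed.

Lemma bounded_lipschitz_coord i j : bounded_lipschitz (fun M => M i j).
Proof. by move=> B _; exists 1 => // M M' h _ _ /(_ i j); rewrite mul1r. Qed.

Lemma bounded_lipschitzD f g : bounded_lipschitz f -> bounded_lipschitz g ->
  bounded_lipschitz (fun M => f M + g M).
Proof.
move=> lf lg B B0; have [C C0 hC] := lf B B0; have [D D0 hD] := lg B B0.
exists (C + D) => [|M M' h MB M'B MM']; first exact: addr_ge0.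
rewrite opprD addrACA mulrDl (le_trans (ler_normD _ _)) // lerD //.
  exact: hC.
exact: hD.
Qed.

Lemma bounded_lipschitz_bounded f (B : R) : bounded_lipschitz f -> 0 <= B ->
  exists2 F : R, 0 <= F & forall M, (forall i j, `|M i j| <= B) -> `|f M| <= F.
Proof.
move=> lf B0; have [C C0 hC] := lf B B0.
exists (`|f 0| + C * B) => [|M MB]; first by rewrite addr_ge0 // mulr_ge0.
rewrite -[f M](subrK (f 0)) addrC (le_trans (ler_normD _ _)) // lerD2l.
by apply: hC => // i j; rewrite mxE ?subr0 // normr0.
Qed.

Lemma bounded_lipschitzM f g : bounded_lipschitz f -> bounded_lipschitz g ->
  bounded_lipschitz (fun M => f M * g M).
Proof.
move=> lf lg B B0; have [C C0 hC] := lf B B0; have [D D0 hD] := lg B B0.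
have [F F0 hF] := bounded_lipschitz_bounded lf B0.
have [G G0 hG] := bounded_lipschitz_bounded lg B0.
exists (F * D + G * C) => [|M M' h MB M'B MM'].
  by rewrite addr_ge0 // mulr_ge0.
have -> : f M * g M - f M' * g M' =
  f M * (g M - g M') + g M' * (f M - f M') by ring.
rewrite (le_trans (ler_normD _ _)) // !normrM mulrDl -!mulrA.
by apply: lerD; apply: ler_pM => //; [exact: hF|exact: hD|exact: hG|exact: hC].
Qed.

Lemma bounded_lipschitz_sum (I : Type) (r : seq I) (P : pred I)
    (F : I -> 'M[R]_(m, n) -> R) : (forall i, bounded_lipschitz (F i)) ->
  bounded_lipschitz (fun M => \sum_(i <- r | P i) F i M).
Proof.
move=> lF; have -> : (fun M => \sum_(i <- r | P i) F i M) =
    \big[(fun f g M => f M + g M)/(fun=> 0)]_(i <- r | P i) F i.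
  by apply: funext => M; elim/big_rec2: _ => // i f y _ <-.
elim/big_ind: _ => [|f g|i _].
- exact: bounded_lipschitz_cst.
- exact: bounded_lipschitzD.
- exact: lF.
Qed.

Lemma bounded_lipschitz_prod (I : Type) (r : seq I) (P : pred I)
    (F : I -> 'M[R]_(m, n) -> R) : (forall i, bounded_lipschitz (F i)) ->
  bounded_lipschitz (fun M => \prod_(i <- r | P i) F i M).
Proof.
move=> lF; have -> : (fun M => \prod_(i <- r | P i) F i M) =
    \big[(fun f g M => f M * g M)/(fun=> 1)]_(i <- r | P i) F i.
  by apply: funext => M; elim/big_rec2: _ => // i f y _ <-.
elim/big_ind: _ => [|f g|i _].
- exact: bounded_lipschitz_cst.
- exact: bounded_lipschitzM.
- exact: lF.
Qed.

Lemma bounded_lipschitz_det (k : nat) (Q : 'M[R]_(m, n) -> 'M[R]_k) :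
  (forall a b, bounded_lipschitz (fun M => Q M a b)) ->
  bounded_lipschitz (fun M => \det (Q M)).
Proof.
move=> lQ; apply: bounded_lipschitz_sum => s.
apply: bounded_lipschitzM; first exact: bounded_lipschitz_cst.
by apply: bounded_lipschitz_prod => a; apply: lQ.
Qed.

Lemma open_neq0 f : bounded_lipschitz f ->
  open [set M : 'M[R]_(m, n) | f M != 0]%classic.
Proof.
move=> lf; rewrite openE => M /= fM0.
(* The margin [1] keeps the ball of radius [e <= 1] inside the cube of size [B]; the divisor [C + 1]
   in [e] gives [C * e < |f M|], even when [C = 0]. *)
pose B := \sum_i \sum_j `|M i j| + 1.
have MB i j : `|M i j| <= B - 1.
  rewrite /B addrK (bigD1 i) //= (bigD1 j) //= -addrA lerDl.
  by rewrite addr_ge0 ?sumr_ge0 // => *; rewrite sumr_ge0.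
have B0 : 0 <= B by rewrite addr_ge0 // sumr_ge0 // => *; rewrite sumr_ge0.
have [C C0 hC] := lf B B0.
pose e := Num.min 1 (`|f M| / (C + 1)).
have C1 : 0 < C + 1 by rewrite ltr_wpDl.
have e0 : 0 < e by rewrite lt_min ltr01 divr_gt0 // normr_gt0.
apply/nbhs_ballP; exists e => // M' MM' /=.
have {}MM' i j : `|M i j - M' i j| < e by case: MM' => _ /(_ i j).
apply/eqP => fM'0.
have : `|f M - f M'| <= C * e.
  apply: hC => i j; last exact: ltW.
    by rewrite (le_trans (MB i j)) // gerBl.
  rewrite -[M' i j](subKr (M i j)) (le_trans (ler_normB _ _)) //.
  rewrite -[B](subrK 1) lerD // (le_trans (ltW (MM' i j))) //.
  by rewrite ge_min lexx.
apply/negP; rewrite -ltNge fM'0 subr0.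
have : e * (C + 1) <= `|f M| by rewrite -ler_pdivlMr // ge_min lexx orbT.
apply: lt_le_trans; rewrite mulrC mulrDr; lra.
Qed.

End Lipschitz.

(** * Zeros of multi-affine functions *)

Section MultiAffine.
Variables (R : realType) (m n : nat).
Implicit Types (f g : 'M[R]_(m, n) -> R) (M : 'M[R]_(m, n)).

Definition multi_affine f := forall M i j t,
  f (M + t *: delta_mx i j) = (1 - t) * f M + t * f (M + delta_mx i j).

(** For a multi-affine [f], the partial derivative in the entry [(i, j)]. *)
Definition slope i j f M := f (M + delta_mx i j) - f M.

Lemma multi_affineE f M i j t : multi_affine f ->
  f (M + t *: delta_mx i j) = f M + t * slope i j f M.
Proof. by move=> ->; rewrite /slope; ring. Qed.

Lemma multi_affine_slope i j f : multi_affine f -> multi_affine (slope i j f).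
Proof.
move=> mf M i' j' t; rewrite /slope mf.
rewrite addrAC mf [M + delta_mx i' j' + delta_mx i j]addrAC; ring.
Qed.

(** An affine function of one entry has constant derivative in it; this is how the induction of
    [multi_affine_zeros] loses a variable. *)
Lemma slope_invariant i j f M t : multi_affine f ->
  slope i j f (M + t *: delta_mx i j) = slope i j f M.
Proof.
move=> mf; rewrite {1}/slope -addrA -{2}[delta_mx i j]scale1r -scalerDl.
by rewrite !multi_affineE //; ring.
Qed.

Lemma bounded_lipschitz_slope i j f :
  bounded_lipschitz f -> bounded_lipschitz (slope i j f).
Proof.
move=> lf B B0; have [C C0 hC] := lf (B + 1) (addr_ge0 B0 ler01).
exists (C + C) => [|M M' h MB M'B MM']; first exact: addr_ge0.
have Bd (A : 'M[R]_(m, n)) : (forall i j, `|A i j| <= B) ->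
    forall i' j', `|(A + delta_mx i j) i' j'| <= B + 1.
  move=> AB i' j'; rewrite !mxE (le_trans (ler_normD _ _)) // lerD //.
  by case: (_ && _); rewrite ?normr1 ?normr0.
have -> : slope i j f M - slope i j f M' =
  (f (M + delta_mx i j) - f (M' + delta_mx i j)) - (f M - f M').
  by rewrite /slope; ring.
rewrite (le_trans (ler_normB _ _)) // mulrDl lerD //; apply: hC => //.
- exact: Bd.
- exact: Bd.
- by move=> i' j'; rewrite !mxE opprD addrACA subrr addr0.
- by move=> i' j'; rewrite (le_trans (MB _ _)) // lerDl.
- by move=> i' j'; rewrite (le_trans (M'B _ _)) // lerDl.
Qed.

Lemma grid_cell (K : nat) (h y : R) : 0 <= y <= K.+1%:R * h ->
  exists k : 'I_K.+1, k%:R * h <= y <= k.+1%:R * h.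
Proof.
elim: K => [|K IH] /andP[y0 yK].
  by exists ord0; rewrite mul0r y0.
have [yK'|/ltW yK'] := leP y (K.+1%:R * h).
  have [|k hk] := IH; first by rewrite y0.
  by exists (widen_ord (leqnSn _) k).
by exists ord_max; rewrite yK' yK.
Qed.

(* On a column of the grid over the coordinates other than [(i0, j0)], two
   zeros of [f] have [(i0, j0)]-entries at distance at most a constant times the
   mesh, so one thin box covers all the zeros in the column. *)
Lemma null_set_steep_zeros f i0 j0 (B : nat) :
  bounded_lipschitz f -> multi_affine f ->
  null_set [set M : 'M[R]_(m, n) | [/\ forall i j, `|M i j| <= B.+1%:R, f M = 0 &
                       1 <= B.+1%:R * `|slope i0 j0 f M|]]%classic.
Proof.
move=> lf mf; set S := mkset _.
pose v := (i0, j0); pose b : R := B.+1%:R.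
have b0 : 0 < b by rewrite ltr0n.
have [C C0 hC] := lf b (ltW b0).
apply: (null_set_countable v) => eps eps0.
(* [D / K.+1%:R] will be the total volume of the boxes, whence the choice of [K]. *)
pose D := 2 * (b * C) * (2 * b) * (2 * b) ^+ #|predC1 v|.
have D0 : 0 <= D by rewrite !mulr_ge0 ?exprn_ge0 ?mulr_ge0 // ltW.
have [K hK] : exists K : nat, D / eps < K.+1%:R.
  exists (Num.bound (D / eps)); apply: lt_trans (archi_boundP _) _.
    by rewrite divr_ge0 // ltW.
  by rewrite ltr_nat.
pose h := 2 * b / K.+1%:R.
have h0 : 0 < h by rewrite divr_gt0 ?mulr_gt0 ?ltr0n.
have Kh : K.+1%:R * h = 2 * b by rewrite /h mulrC divfK // pnatr_eq0.
pose w := b * C * h.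
have w0 : 0 <= w by apply: mulr_ge0 (mulr_ge0 (ltW b0) C0) (ltW h0).
(* An index [c] also has a value at [v]. Width [0] for all these values but [ord0] lets the sum over
   all [c] factor, while each column counts once. *)
pose width (p : 'I_m * 'I_n) (k : 'I_K.+1) : R :=
  if p == v then (if k == ord0 then 2 * w else 0) else h.
have width0 p k : 0 <= width p k.
  by rewrite /width; case: ifP => _; [case: ifP => _ //; exact: mulr_ge0|exact: ltW].
pose T : finType := {ffun 'I_m * 'I_n -> 'I_K.+1}.
pose column (c : T) : set 'M[R]_(m, n) := [set M | S M /\
  forall p, p != v -> (c p)%:R * h <= M p.1 p.2 + b <= (c p).+1%:R * h]%classic.
(* A reference zero in the column; the default [0] is taken only for empty columns, where there is
   nothing to cover. *)
pose P c := xget 0 (column c).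
pose lo (c : T) : 'M[R]_(m, n) := \matrix_(i, j)
  if (i, j) == v then P c i0 j0 - w else (c (i, j))%:R * h - b.
pose hi (c : T) : 'M[R]_(m, n) := \matrix_(i, j) (lo c i j + width (i, j) (c (i, j))).
exists T, lo, hi; split=> [c i j|M SM|s us].
- by rewrite [leRHS]mxE lerDl.
- have [MB fM0 sM] := SM.
  have /fin_all_exists[k hk] p : exists k : 'I_K.+1,
      k%:R * h <= M p.1 p.2 + b <= k.+1%:R * h.
    apply: grid_cell; rewrite Kh; have := MB p.1 p.2; rewrite ler_norml -/b.
    by move=> /andP[? ?]; apply/andP; split; lra.
  pose c : T := [ffun p => if p == v then ord0 else k p].
  have colM : column c M by split=> // p /negPf pv; rewrite ffunE pv.
  have [[P'B fP0 sP] colP] : column c (P c) by apply: (xgetI _ colM).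
  exists c => i j; rewrite [hi c i j]mxE [lo c i j]mxE /width.
  have [ev|ev] := eqVneq (i, j) v; last first.
    have /andP[h1 h2] := colM.2 (i, j) ev.
    by move: h2; rewrite /= -natr1 mulrDl mul1r => h2; apply/andP; split; lra.
  rewrite ev ffunE eqxx eqxx; case: ev => -> ->.
  suff : `|P c i0 j0 - M i0 j0| <= w.
    by rewrite ler_norml => /andP[? ?]; apply/andP; split; lra.
  set tau := P c i0 j0 - M i0 j0.
  (* [M1] has the [v]-entry of [P c] and the other entries of [M], so it is within [h] of [P c], and
     [f M1] is [tau] times the slope because [f M = 0]. Steepness then bounds [tau] by [w]. *)
  pose M1 := M + tau *: delta_mx i0 j0.
  have M1v : M1 i0 j0 = P c i0 j0 by rewrite !mxE !eqxx mulr1 addrC subrK.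
  have M1o i' j' : (i', j') != v -> M1 i' j' = M i' j'.
    rewrite xpair_eqE negb_and !mxE => /orP[/negPf->|/negPf->];
      by rewrite ?andbF mulr0 addr0.
  have : `|f M1 - f (P c)| <= C * h.
    apply: hC => // i' j'.
      have [[-> ->]|/M1o ->] := eqVneq (i', j') v; last exact: MB.
      by rewrite M1v; apply: P'B.
    have [[-> ->]|ev] := eqVneq (i', j') v; first by rewrite M1v subrr normr0 ltW.
    rewrite M1o //.
    have /andP[h1 h2] := colM.2 _ ev; have /andP[h3 h4] := colP _ ev.
    move: h1 h2 h3 h4; rewrite /= -natr1 mulrDl mul1r => h1 h2 h3 h4.
    by rewrite ler_norml; apply/andP; split; lra.
  rewrite fP0 subr0 multi_affineE // fM0 add0r normrM => le1.
  rewrite -[`|tau|]mulr1 /w.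
  apply: le_trans (_ : `|tau| * (b * `|slope i0 j0 f M|) <= _).
    by rewrite ler_wpM2l.
  by rewrite mulrCA -mulrA ler_wpM2l // ltW.
have vol c : box_vol (lo c) (hi c) = \prod_p width p (c p).
  rewrite /box_vol pair_big /=; apply: eq_bigr => -[i j] _ /=.
  by rewrite [hi c i j]mxE addrC addrA addNr add0r.
apply: (@le_lt_trans _ _ (\sum_c box_vol (lo c) (hi c))).
  apply: ler_sum_uniq => // [c||c _]; rewrite ?index_enum_uniq ?mem_index_enum //.
  by rewrite vol prodr_ge0.
under eq_bigr do rewrite vol.
rewrite -bigA_distr_bigA (bigD1 v) //=.
have -> : \sum_k width v k = 2 * w.
  rewrite (bigD1 ord0) //= big1 => [|k /negPf k0]; rewrite /width !eqxx ?k0 //.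
  by rewrite addr0.
have -> : \prod_(p | p != v) \sum_k width p k = (2 * b) ^+ #|predC1 v|.
  rewrite -prodr_const; apply: eq_bigr => p /negPf pv.
  by rewrite /width pv sumr_const card_ord -[h *+ _]mulr_natl Kh.
have -> : 2 * w * (2 * b) ^+ #|predC1 v| = D / K.+1%:R.
  by rewrite /w /h /D; ring.
by rewrite ltr_pdivrMr ?ltr0n // mulrC -ltr_pdivrMr.
Qed.

Lemma invariant_cst f :
  (forall M i j t, f (M + t *: delta_mx i j) = f M) -> forall M, f M = f 0.
Proof.
move=> inv M; rewrite (matrix_sum_delta M) pair_big /=.
by elim: index_enum => [|p r IH]; rewrite ?big_nil // big_cons addrC inv.
Qed.

Lemma multi_affine_zeros f (v : 'I_m * 'I_n) :
  bounded_lipschitz f -> multi_affine f -> (exists M, f M != 0) ->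
  null_set [set M | f M = 0]%classic /\
  forall M (e : R), 0 < e ->
    exists2 M' : 'M[R]_(m, n), (forall i j, `|M i j - M' i j| < e) & f M' != 0.
Proof.
(* Induction on a list [s] of the entries on which [f] may depend. When the slope in the head entry
   vanishes identically, that entry is dropped; otherwise the induction hypothesis applies to the
   slope. *)
suff main (s : seq ('I_m * 'I_n)) : forall f,
    (forall M i j t, (i, j) \notin s -> f (M + t *: delta_mx i j) = f M) ->
    bounded_lipschitz f -> multi_affine f -> (exists M, f M != 0) ->
    null_set [set M | f M = 0]%classic /\
    forall M (e : R), 0 < e ->
      exists2 M' : 'M[R]_(m, n), (forall i j, `|M i j - M' i j| < e) & f M' != 0.
  by apply: (main (index_enum _)) => M i j t; rewrite mem_index_enum.
elim: s => [|[i0 j0] s IH] {}f fs lf mf [M0 fM0].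
  have fE M : f M = f M0.
    by rewrite (@invariant_cst f) ?[in RHS](@invariant_cst f) // => *; apply: fs.
  split; last first.
    by move=> M e e0; exists M; rewrite ?fE // => i j; rewrite subrr normr0.
  apply: (null_setS _ (null_set0 v)) => M /= fM.
  by move: fM0; rewrite -(fE M) fM eqxx.
have [[M1 sM1]|sl0] := pselect (exists M, slope i0 j0 f M != 0); last first.
  apply: IH => //; last by exists M0.
  move=> M i j t ijs; have [[-> ->]|ij0] := eqVneq (i, j) (i0, j0).
    rewrite multi_affineE //; have -> : slope i0 j0 f M = 0.
      by apply/eqP; apply: contrapT => /negP s0; apply: sl0; exists M.
    by rewrite mulr0 addr0.
  by rewrite fs // inE negb_or ij0.
have [||||nS dS] := IH (slope i0 j0 f).
- move=> M i j t ijs; have [[-> ->]|ij0] := eqVneq (i, j) (i0, j0).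
    exact: slope_invariant.
  by rewrite /slope addrAC !fs // inE negb_or ij0.
- exact: bounded_lipschitz_slope.
- exact: multi_affine_slope.
- by exists M1.
split=> [|M e e0].
  apply: (null_setS _ (null_setU v nS (null_set_bigcup v
    (fun B => null_set_steep_zeros i0 j0 B lf mf)))) => M /= fM.
  have [s0|s0] := eqVneq (slope i0 j0 f M) 0; [by left|right].
  pose b := Num.max (\sum_i \sum_j `|M i j|) `|slope i0 j0 f M|^-1.
  have b0 : 0 <= b by rewrite le_max invr_ge0 normr_ge0 orbT.
  have bB : b <= (Num.bound b).+1%:R.
    by rewrite (le_trans (ltW (archi_boundP b0))) // ler_nat.
  exists (Num.bound b) => //; split=> // [i j|].
    apply: le_trans bB; rewrite le_max (bigD1 i) //= (bigD1 j) //= -addrA lerDl.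
    by rewrite addr_ge0 ?sumr_ge0 // => *; rewrite sumr_ge0.
  rewrite -ler_pdivrMr ?normr_gt0 // mul1r; apply: le_trans bB.
  by rewrite le_max lexx orbT.
have [|M' MM' sM'] := dS M (e / 2); first by rewrite divr_gt0.
have [fM'|fM'] := eqVneq (f M') 0; last first.
  by exists M' => // i j; rewrite (lt_trans (MM' i j)) //; lra.
exists (M' + (e / 2) *: delta_mx i0 j0) => [i j|]; last first.
  rewrite multi_affineE // fM' add0r mulf_neq0 //.
  by rewrite mulf_neq0 ?invr_eq0 ?pnatr_eq0 // gt_eqF.
rewrite !mxE opprD addrA (le_lt_trans (ler_normB _ _)) //.
have : `|e / 2 * ((i == i0) && (j == j0))%:R| <= e / 2.
  by case: (_ && _); rewrite ?mulr1 ?mulr0 ?normr0 ?ger0_norm //; lra.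
by have := MM' i j; lra.
Qed.

Lemma generic_neq0 f (v : 'I_m * 'I_n) :
  bounded_lipschitz f -> multi_affine f -> (exists M, f M != 0) ->
  generic (fun M => f M != 0).
Proof.
move=> lf mf f0; have [nf df] := multi_affine_zeros v lf mf f0.
exists [set M | f M != 0]%classic; split; first exact: open_neq0.
split=> [O [M OM] oO|].
  have := oO; rewrite openE => /(_ _ OM) /nbhs_ballP[e /= e0 eO].
  have [M' MM' fM'] := df M e e0.
  by exists M'; split => //; apply: eO; split=> // i j; apply: MM'.
split=> //; by apply: (null_setS _ nf) => M /= /negP; rewrite negbK => /eqP.
Qed.

End MultiAffine.

(** * Closure properties of genericity *)

Section Generic.
Variables (R : realType) (m n : nat).
Implicit Types P Q : 'M[R]_(m, n) -> Prop.

Lemma genericS P Q : (forall M, P M -> Q M) -> generic P -> generic Q.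
Proof.
by move=> PQ [U [oU [dU [nU UP]]]]; exists U; do 3?split=> //; move=> M /UP/PQ.
Qed.

Lemma genericT (v : 'I_m * 'I_n) : generic (fun _ : 'M[R]_(m, n) => True).
Proof.
exists setT; split; first exact: openT.
split; first by move=> O [M OM] _; exists M.
by split=> //; rewrite setCT; apply: null_set0.
Qed.

Lemma genericI (v : 'I_m * 'I_n) P Q :
  generic P -> generic Q -> generic (fun M => P M /\ Q M).
Proof.
move=> [U [oU [dU [nU UP]]]] [V [oV [dV [nV VQ]]]].
exists (U `&` V)%classic; split; first exact: openI.
split; first exact: denseI.
split; first by rewrite setCI; apply: null_setU.
by move=> M [/UP ? /VQ].
Qed.

Lemma generic_forall (v : 'I_m * 'I_n) (T : finType)
    (P : T -> 'M[R]_(m, n) -> Prop) :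
  (forall t, generic (P t)) -> generic (fun M => forall t, P t M).
Proof.
move=> gP; suff : generic (fun M => forall t, t \in enum T -> P t M).
  by apply: genericS => M PM t; apply: PM; rewrite mem_enum.
elim: (enum T) => [|t s IH]; first by apply: (genericS _ (genericT v)).
apply: (genericS _ (genericI v (gP t) IH)) => M [Pt Ps] t'.
by rewrite inE => /orP[/eqP->|/Ps].
Qed.

End Generic.

(** * Generic independence of the rows of a system *)

Section GenericRows.
Variables (R : realType) (m p n : nat) (L : 'I_m -> 'M[R]_(p, n)).

Definition first_rows (k : nat) (km : (k <= m)%N) (M : 'M[R]_(m, p)) :
    'M[R]_(k, n) :=
  \matrix_(a < k) (row (widen_ord km a) M *m L (widen_ord km a)).

(** Freeness at one matrix gives a nonzero minor on the columns [h]. That minor is multi-affine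
    because an entry of [M] occurs in at most one of its rows, so it is generically nonzero. *)
Lemma generic_first_rows_free (v : 'I_m * 'I_p) (k : nat) (km : (k <= m)%N) :
  (exists M, row_free (first_rows km M)) ->
  generic (fun M => row_free (first_rows km M)).
Proof.
move=> [M0 free0].
have full0 : row_full (first_rows km M0)^T by rewrite /row_full mxrank_tr.
pose h := fullrankfun full0.
pose Q M := colsub h (first_rows km M).
have QE M a b : Q M a b =
    \sum_c M (widen_ord km a) c * L (widen_ord km a) c (h b).
  by rewrite mxE mxE mxE; apply: eq_bigr => c _; rewrite mxE.
have detQ0 : \det (Q M0) != 0.
  have := fullrowsub_unit full0; rewrite -/h -unitmx_tr trmx_mxsub trmxK.
  by rewrite unitmxE unitfE.
apply: (@genericS _ _ _ (fun M => \det (Q M) != 0)) => [M detQ|].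
  have QU : Q M \in unitmx by rewrite unitmxE unitfE.
  move: QU; rewrite -row_free_unit /Q -[first_rows km M]mulmx1 -mulmx_colsub.
  rewrite mulmx1 /row_free => /eqP rQ.
  by rewrite eqn_leq rank_leq_row -{1}rQ mxrankM_maxl.
apply: (generic_neq0 v); last by exists M0.
- apply: bounded_lipschitz_det => a b.
  under [X in bounded_lipschitz X]funext => M do rewrite QE.
  apply: bounded_lipschitz_sum => c; apply: bounded_lipschitzM.
    exact: bounded_lipschitz_coord.
  exact: bounded_lipschitz_cst.
move=> M i j t.
have Qother a s : widen_ord km a != i ->
    forall b, Q (M + s *: delta_mx i j) a b = Q M a b.
  move=> /negPf ai b; rewrite !QE; apply: eq_bigr => c _.
  by rewrite !mxE ai mulr0 addr0.
have Qother1 a : widen_ord km a != i ->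
    forall b, Q (M + delta_mx i j) a b = Q M a b.
  by move=> ai b; rewrite -[delta_mx i j]scale1r Qother.
have [ik|ik] := ltnP i k; last first.
  have ai a : widen_ord km a != i.
    by rewrite -val_eqE /= neq_ltn (leq_trans (ltn_ord a) ik).
  have -> : Q (M + t *: delta_mx i j) = Q M.
    by apply/matrixP => a b; apply: Qother.
  have -> : Q (M + delta_mx i j) = Q M.
    by apply/matrixP => a b; apply: Qother1.
  ring.
have aE a : widen_ord km (lift (Ordinal ik) a) != i.
  have := neq_lift (Ordinal ik) a.
  by rewrite -!val_eqE /= eq_sym.
apply: (determinant_multilinear (i0 := Ordinal ik)).
- apply/rowP => b; rewrite ![in LHS]mxE [in RHS]mxE.
  rewrite ![((_ *: row _ _) _ _)]mxE ![row _ _ _ _]mxE !QE.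
  rewrite !mulr_sumr -big_split /=; apply: eq_bigr => c _; rewrite !mxE; ring.
- by apply/matrixP => a b; rewrite [LHS]mxE [RHS]mxE Qother.
- by apply/matrixP => a b; rewrite [LHS]mxE [RHS]mxE Qother // Qother1.
Qed.

(* A vector [z] outside all the kernels [L j] is not killed by a suitable
   choice of the next row, so if the rows before kill [z] then the next row
   can be chosen independent of them; hence it is so generically, and [m >= n]
   generically independent rows would leave no [z != 0] in the kernel. *)
Lemma generic_no_kernel (v : 'I_m * 'I_p) : (n <= m)%N ->
  generic (fun M => forall z : 'cV[R]_n, (forall j, L j *m z != 0) ->
    exists j, row j M *m L j *m z != 0).
Proof.
move=> nm.
have gfree : generic (fun M => forall k : 'I_m.+1,
    (exists M0, row_free (first_rows (ltn_ord k : k <= m)%N M0)) ->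
    row_free (first_rows (ltn_ord k : k <= m)%N M)).
  apply: (generic_forall v) => k.
  have [/(generic_first_rows_free v)|nM] :=
    pselect (exists M0, row_free (first_rows (ltn_ord k : k <= m)%N M0)).
    by apply: genericS => M.
  by apply: (genericS _ (genericT _ v)) => M _ /nM.
apply: (genericS _ gfree) => M gM z Lz; apply: contrapT => noj.
have {}noj j : row j M *m L j *m z = 0.
  by apply/eqP; apply: contrapT => /negP jz; apply: noj; exists j.
have {}gM k (km : (k <= m)%N) : (exists M0, row_free (first_rows km M0)) ->
    row_free (first_rows km M).
  have km' : (k < m.+1)%N by [].
  by rewrite (bool_irrelevance km (ltn_ord (Ordinal km'))); exact: (gM (Ordinal km')).
have free k (km : (k <= m)%N) : row_free (first_rows km M).
  elim: k km => [|k IH] km; first by rewrite /row_free eqn_leq rank_leq_row.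
  apply: gM; set ik := Ordinal km; have kz := Lz ik.
  have [c Lzc] : exists c, (L ik *m z) c ord0 != 0.
    apply: contrapT => no; move/negP: kz; apply; apply/eqP/matrixP => c o.
    rewrite (ord1 o) [RHS]mxE; apply/eqP; apply: contrapT => /negP cz.
    by apply: no; exists c.
  (* The new row is the unit vector at [c], so its product with [L ik *m z] is the nonzero entry
     found there. *)
  pose M0 : 'M[R]_(m, p) := \matrix_(i, j) if i == ik then (j == c)%:R else M i j.
  exists M0; apply: inj_row_free => w w0.
  have rowM0 i : i != ik -> row i M0 = row i M.
    by move=> /negPf ii; apply/rowP => j; rewrite !mxE ii.
  have wid a : widen_ord km (widen_ord (leqnSn k) a) = widen_ord (ltnW km) a.
    exact: val_inj.
  have widN a : widen_ord (ltnW km) a != ik.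
    by rewrite -val_eqE /= neq_ltn ltn_ord.
  have ordm : widen_ord km ord_max = ik by apply: val_inj.
  have sumE : w *m first_rows km M0 =
      \sum_(a < k) w ord0 (widen_ord (leqnSn k) a) *:
         (row (widen_ord (ltnW km) a) M *m L (widen_ord (ltnW km) a)) +
      w ord0 ord_max *: (row ik M0 *m L ik).
    rewrite mulmx_sum_row big_ord_recr /= rowK ordm; congr (_ + _).
    by apply: eq_bigr => a _; rewrite rowK wid rowM0.
  (* Multiplied by [z], the relation loses its first [k] terms, so the last coefficient is zero. *)
  have wmax : w ord0 ord_max = 0.
    have := congr1 (mulmx^~ z) w0; rewrite mul0mx sumE mulmxDl mulmx_suml big1.
      rewrite add0r -scalemxAl -mulmxA.
      have -> : row ik M0 = delta_mx 0 c.
        by apply/rowP => j; rewrite !mxE !eqxx.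
      move: (L ik *m z) Lzc => q qc; rewrite -rowE => /rowP/(_ ord0)/eqP.
      by rewrite !mxE mulf_eq0 (negPf qc) orbF => /eqP.
    by move=> a _; rewrite -scalemxAl noj scaler0.
  move: w0; rewrite sumE wmax scale0r addr0 => w0.
  have /(row_free_inj (IH (ltnW km))) w'0 :
      (\row_a w ord0 (widen_ord (leqnSn k) a)) *m first_rows (ltnW km) M =
      0 *m first_rows (ltnW km) M.
    rewrite mul0mx -w0 mulmx_sum_row; apply: eq_bigr => a _.
    by rewrite rowK mxE.
  apply/rowP => a; rewrite [RHS]mxE.
  have [ak|ak] := ltnP a k; last first.
    by rewrite -wmax; congr (w _ _); apply: val_inj => /=; have := ltn_ord a; lia.
  move/rowP: w'0 => /(_ (Ordinal ak)); rewrite !mxE => <-.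
  by congr (w _ _); apply: val_inj.
(* The [m] rows are independent, and [n <= m], so the rank is also the number [n] of columns. *)
have fullQ : row_full (first_rows (leqnn m) M).
  have /eqP r := free m (leqnn m).
  by rewrite /row_full eqn_leq rank_leq_col r.
have z0 : z = 0.
  apply: (row_full_inj fullQ); rewrite mulmx0; apply/row_matrixP => a.
  by rewrite row_mul rowK noj row0.
by have := Lz v.1; rewrite z0 mulmx0 eqxx.
Qed.

End GenericRows.

(** * Generic sparse affine phase retrieval *)

Lemma generic_sparse_affine_PR (R : realType) (m d s : nat) :
  (2 * s + 1 <= m)%N ->
  generic (fun M : 'M[R]_(m, d + 1) =>
    sparse_affine_PR s (lsubmx M) (rsubmx M)).
Proof.
move=> sm; have m0 : (0 < m)%N by lia.
pose v : 'I_m * 'I_(d + 1) := (Ordinal m0, rshift d ord0).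
pose E (T : {set 'I_d}) : 'M[R]_(d, #|T|) := colsub enum_val 1%:M.
(* Applied to [z = (x, y, 1)], [L] gives [(x - y, 0)] for equal signs and [(x + y, 2)] for opposite
   ones; pairing with [(a_j, b_j)] yields the two kinds of equations. *)
pose L (T1 T2 : {set 'I_d}) (pos : bool) :
    'M[R]_(d + 1, #|T1| + #|T2| + 1) :=
  if pos then col_mx (row_mx (row_mx (E T1) (- E T2)) 0) 0
  else block_mx (row_mx (E T1) (E T2)) 0 0 2%:M.
(* The size bound is a premise inside [P], so that [t] ranges over a plain finite type, as in
   [generic_forall]. *)
pose P (t : {set 'I_d} * {set 'I_d} * {ffun 'I_m -> bool})
    (M : 'M[R]_(m, d + 1)) :=
  (#|t.1.1| + #|t.1.2| + 1 <= m)%N ->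
  forall z : 'cV_(#|t.1.1| + #|t.1.2| + 1),
    (forall j, L t.1.1 t.1.2 (t.2 j) *m z != 0) ->
    exists j, row j M *m L t.1.1 t.1.2 (t.2 j) *m z != 0.
have gen : generic (fun M => forall t, P t M).
  apply: (generic_forall v) => -[[T1 T2] eps]; rewrite /P /=.
  have [le|gt] := leqP (#|T1| + #|T2| + 1) m.
    exact: (genericS _ (generic_no_kernel (fun j => L T1 T2 (eps j)) v le)).
  by apply: (genericS _ (genericT _ v)).
apply: (genericS _ gen) => M gM x y sx sy xy.
apply/eqP; apply: contrapT => /negP xNy.
pose T1 := [set i | x i ord0 != 0]; pose T2 := [set i | y i ord0 != 0].
have xE : E T1 *m rowsub enum_val x = x.
  by apply: colsub1_support => i; rewrite inE negbK => /eqP.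
have yE : E T2 *m rowsub enum_val y = y.
  by apply: colsub1_support => i; rewrite inE negbK => /eqP.
pose a j := (lsubmx M *m x) j ord0; pose a' j := (lsubmx M *m y) j ord0.
pose b j := rsubmx M j ord0.
(* [eps] marks the rows where the two affine forms coincide; elsewhere equal absolute values make
   them opposite. *)
pose eps := [ffun j => a j + b j == a' j + b j].
pose z : 'cV[R]_(#|T1| + #|T2| + 1) :=
  col_mx (col_mx (rowsub enum_val x) (rowsub enum_val y)) 1%:M.
have LzT : L T1 T2 true *m z = col_mx (x - y) 0.
  rewrite /L /z mul_col_mx !mul_row_col mul0mx mul0mx addr0.
  by rewrite mulNmx xE yE.
have LzF : L T1 T2 false *m z = col_mx (x + y) 2%:M.
  rewrite /L /z mul_block_col !mul_row_col !mul0mx addr0 add0r xE yE.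
  by rewrite mulmx1.
have card12 : (#|T1| + #|T2| + 1 <= m)%N.
  move: sx sy; rewrite !sparseE -/T1 -/T2; lia.
have Lz j : L T1 T2 (eps j) *m z != 0.
  case: (eps j); rewrite ?LzT ?LzF col_mx_eq0 negb_and.
    by rewrite subr_eq0 xNy.
  apply/orP; right; apply/eqP => /matrixP/(_ ord0 ord0)/eqP.
  by rewrite !mxE pnatr_eq0.
have [j] := gM (T1, T2, eps) card12 z Lz.
rewrite /= -mulmxA => /negP; apply; apply/eqP/matrixP => i o.
rewrite (ord1 i) (ord1 o) [RHS]mxE {i o}.
have -> : row j M = row_mx (row j (lsubmx M)) (row j (rsubmx M)).
  by rewrite -row_row_mx hsubmxK.
have abs : `|a j + b j| = `|a' j + b j|.
  by have /matrixP/(_ j ord0) := xy; rewrite [LHS]mxE [RHS]mxE.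
have rowE' (w : 'cV_d) :
    (row j (lsubmx M) *m w) ord0 ord0 = (lsubmx M *m w) j ord0.
  by rewrite -row_mul mxE.
rewrite ffunE; case: eqP => [e|ne].
  rewrite LzT mul_row_col mulmx0 addr0 rowE' mulmxBr [LHS]mxE [X in _ + X]mxE.
  by apply/eqP; rewrite subr_eq0; apply/eqP; apply: (addIr (b j)).
have sumab : a j + b j = - (a' j + b j).
  by move/eqP: abs; rewrite eqr_norm2 => /orP[/eqP//|/eqP].
rewrite LzF mul_row_col [LHS]mxE rowE' mulmxDr [X in X + _]mxE.
rewrite mul_mx_scalar [X in _ + X]mxE [row _ _ _ _]mxE.
by rewrite -/(a j) -/(a' j) -/(b j); lra.
Qed.

Theorem theorem2p5 (R : realType) :
  (forall (m d s : nat) (A : 'M[R]_(m, d)) (b : 'cV[R]_m),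
      (1 <= s)%N -> (s <= d - 1)%N ->
      sparse_affine_PR s A b -> (2 * s + 1 <= m)%N) /\
  (forall m d s : nat, (2 * s + 1 <= m)%N ->
      generic (fun M : 'M[R]_(m, d + 1) =>
        sparse_affine_PR s (lsubmx M) (rsubmx M))).
Proof.
split=> [m d s A b s1 sd PR|m d s sm].
  exact: sparse_affine_PR_lower_bound s1 sd PR.
exact: generic_sparse_affine_PR.
Qed.
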